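(* Let $a,b>0$, $n\in\mathbb{N}$ (so $n\ge 1$) and $v\in\mathbb{R}$. (i) If $v\notin\left[0,\frac{1}{2^n}\right]$, then $$(1-v)a+vb\le a^{1-v}b^v+v\sum_{k=1}^n 2^{k-1}\left(\sqrt a-\sqrt[2^k]{a^{2^{k-1}-1}b}\right)^2.$$ (ii) If $v\notin\left[\frac{2^n-1}{2^n},1\right]$, then $$(1-v)a+vb\le a^{1-v}b^v+(1-v)\sum_{k=1}^n 2^{k-1}\left(\sqrt b-\sqrt[2^k]{ab^{2^{k-1}-1}}\right)^2.$$
   Context: All powers and roots are the usual real powers and roots of positive real numbers; $\sqrt[m]{x}=x^{1/m}$. *)

(* Defs.v *)
From mathcomp Require Import all_boot all_order all_algebra.
From mathcomp Require Import reals exp.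

Set Implicit Arguments.
Unset Strict Implicit.
Unset Printing Implicit Defensive.

Import Order.TTheory GRing.Theory Num.Theory.
Local Open Scope ring_scope.

(* MathComp's [m.-root] lives on algebraically closed fields only, so real
   roots are taken through the real power function. *)
Definition realroot (R : realType) (m : nat) (x : R) : R := x `^ (m%:R^-1).

(* Main.v *)
Require Import Defs.
From mathcomp Require Import all_boot all_order all_algebra.
From mathcomp Require Import reals sequences exp.
From mathcomp Require Import ring lra.

Set Implicit Arguments.
Unset Strict Implicit.
Unset Printing Implicit Defensive.

Import Order.TTheory GRing.Theory Num.Theory.
Local Open Scope ring_scope.

(** Put [c_k = a `^ (1 - 2^-k) * b `^ (2^-k)], so that [c_0 = b].  The root in the
    [k]-th summand is [c_k / sqrt a], and its square is [c_(k-1)]; hence the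
    [k]-th summand equals
    [2^k * (a - c_k) - 2^(k-1) * (a - c_(k-1))] and the sum telescopes
    ([sum_refinement_terms]).  Once the telescoped sum is substituted, (i) says
    [(1 - w) * a + w * c_n <= a `^ (1 - w) * c_n `^ w] for [w = 2^n * v], since
    the right-hand side is again [a `^ (1 - v) * b `^ v].  That is Young's
    inequality with weights outside [0, 1], where it holds reversed
    ([reverse_young]), and [v] lies outside [0, 1/2^n] exactly when [w] lies
    outside [0, 1].  Part (ii) is part (i) with [a], [b] exchanged and [v]
    replaced by [1 - v]. *)

Section RefinedReverseYoung.
Variable R : realType.
Implicit Types a b c v w x y : R.

(** The functional equation carries the tangent at 0 to any point [x]; the choice
    of [x] is what settles each case of [reverse_young]. *)
Lemma expR_ge_tangent x y : expR x * (1 + (y - x)) <= expR y.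
Proof.
rewrite -[in leRHS](subrKC x y) expRD ler_wpM2l ?expR_ge0 //.
exact: expR_ge1Dx.
Qed.

(** Among the logarithms of [a], [c] and [a `^ (1 - w) * c `^ w], the middle
    one is that of [c] if [1 < w] and that of [a] if [w < 0].  The tangent to
    the exponential at the middle point bounds the two outer values from below,
    and the combination in which the linear terms cancel is the claim. *)
Lemma reverse_young a c w : 0 < a -> 0 < c -> w \notin `[0, 1] ->
  (1 - w) * a + w * c <= a `^ (1 - w) * c `^ w.
Proof.
move=> a0 c0; rewrite in_itv /= negb_and -!ltNge => w01.
rewrite /powR !gt_eqF // -expRD.
rewrite -[in X in X <= _](lnK a0) -[in X in X <= _](lnK c0).
set x := ln a; set y := ln c; set m := (X in _ <= expR X).
case/orP: w01 => hw.
- have hm := expR_ge_tangent x m.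
  have hy : - w * (expR x * (1 + (y - x))) <= - w * expR y.
    by rewrite ler_wpM2l ?expR_ge_tangent // oppr_ge0 ltW.
  have -> : (1 - w) * expR x =
            expR x * (1 + (m - x)) - w * (expR x * (1 + (y - x))).
    by rewrite /m; ring.
  lra.
- have hm := expR_ge_tangent y m.
  have hx : (w - 1) * (expR y * (1 + (x - y))) <= (w - 1) * expR x.
    by rewrite ler_wpM2l ?expR_ge_tangent // subr_ge0 ltW.
  have -> : w * expR y =
            expR y * (1 + (m - y)) + (w - 1) * (expR y * (1 + (x - y))).
    by rewrite /m; ring.
  lra.
Qed.

Definition dyadic_mean a b k : R := a `^ (1 - 2 ^- k) * b `^ (2 ^- k).

Lemma dyadic_mean_gt0 a b k : 0 < a -> 0 < b -> 0 < dyadic_mean a b k.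
Proof. by move=> a0 b0; rewrite mulr_gt0 ?powR_gt0. Qed.

Lemma dyadic_mean0 a b : 0 < a -> 0 < b -> dyadic_mean a b 0 = b.
Proof.
by move=> a0 b0; rewrite /dyadic_mean expr0 invr1 subrr powRr0 mul1r powRr1 ?ltW.
Qed.

Lemma dyadic_root_expR a b k : 0 < a -> 0 < b ->
  realroot (2 ^ k.+1) (a ^+ (2 ^ k - 1) * b) =
  expR ((2^-1 - 2 ^- k.+1) * ln a + 2 ^- k.+1 * ln b).
Proof.
move=> a0 b0; rewrite /realroot /powR gt_eqF ?mulr_gt0 ?exprn_gt0 //.
rewrite lnM ?posrE ?exprn_gt0 // lnXn // -[ln a *+ _]mulr_natl.
rewrite natrB ?expn_gt0 // !natrX; congr expR.
have : 2 ^+ k != 0 :> R by rewrite expf_neq0 ?pnatr_eq0.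
by move=> h; rewrite !exprS; field.
Qed.

(** With [r] the root, [sqrt a * r] is the mean at level [k.+1] and squaring [r]
    doubles its exponents, which gives back the mean at level [k].  In this form
    the square is ready to telescope once it is multiplied by [2 ^+ k]. *)
Lemma sqr_sub_dyadic_root a b k : 0 < a -> 0 < b ->
  (Num.sqrt a - realroot (2 ^ k.+1) (a ^+ (2 ^ k - 1) * b)) ^+ 2 =
  a - 2 * dyadic_mean a b k.+1 + dyadic_mean a b k.
Proof.
move=> a0 b0; have h : 2 ^+ k != 0 :> R by rewrite expf_neq0 ?pnatr_eq0.
have root_cross : Num.sqrt a * realroot (2 ^ k.+1) (a ^+ (2 ^ k - 1) * b) =
    dyadic_mean a b k.+1.
  rewrite dyadic_root_expR // -powR12_sqrt ?ltW // /dyadic_mean /powR !gt_eqF //.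
  by rewrite -!expRD; congr expR; rewrite exprS; field.
have root_sqr : realroot (2 ^ k.+1) (a ^+ (2 ^ k - 1) * b) ^+ 2 =
    dyadic_mean a b k.
  rewrite dyadic_root_expR // /dyadic_mean /powR !gt_eqF // -expRM_natl.
  by rewrite -expRD; congr expR; rewrite exprS; field.
by rewrite sqrrB sqr_sqrtr ?ltW // root_cross root_sqr -mulr_natl.
Qed.

Lemma sum_refinement_terms a b n : 0 < a -> 0 < b ->
  \sum_(1 <= k < n.+1) 2 ^+ (k - 1) *
    (Num.sqrt a - realroot (2 ^ k) (a ^+ (2 ^ (k - 1) - 1) * b)) ^+ 2 =
  2 ^+ n * (a - dyadic_mean a b n) - (a - b).
Proof.
move=> a0 b0; rewrite big_add1 /=.
under eq_bigr => k _ do rewrite subn1 /= sqr_sub_dyadic_root //.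
pose f k := 2 ^+ k * (a - dyadic_mean a b k).
rewrite (@telescope_sumr_eq _ _ _ f) // /f.
  by rewrite expr0 mul1r dyadic_mean0.
by move=> k _; rewrite exprS; ring.
Qed.

(** The pair [a], [dyadic_mean a b n] with weight [2^n * v] has the same
    weighted geometric mean as the pair [a], [b] with weight [v]. *)
Lemma dyadic_mean_weight a b n v : 0 < a -> 0 < b ->
  a `^ (1 - 2 ^+ n * v) * dyadic_mean a b n `^ (2 ^+ n * v) =
  a `^ (1 - v) * b `^ v.
Proof.
move=> a0 b0; have h : 2 ^+ n != 0 :> R by rewrite expf_neq0 ?pnatr_eq0.
rewrite /dyadic_mean powRM ?powR_ge0 // -!powRrM mulrA -powRD; last first.
  by rewrite (gt_eqF a0) implybT.
by congr (_ `^ _ * _ `^ _); field.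
Qed.

Lemma refined_reverse_young a b n v : 0 < a -> 0 < b ->
  v \notin `[0, 1 / 2 ^+ n] ->
  (1 - v) * a + v * b <=
    a `^ (1 - v) * b `^ v +
    v * \sum_(1 <= k < n.+1) 2 ^+ (k - 1) *
      (Num.sqrt a - realroot (2 ^ k) (a ^+ (2 ^ (k - 1) - 1) * b)) ^+ 2.
Proof.
move=> a0 b0 v_out; have N0 : 0 < 2 ^+ n :> R by rewrite exprn_gt0.
have w_out : 2 ^+ n * v \notin `[0, 1].
  move: v_out; rewrite !in_itv /= ler_pdivlMr // pmulr_rge0 //.
  by rewrite [v * _]mulrC.
have := reverse_young a0 (dyadic_mean_gt0 n a0 b0) w_out.
rewrite dyadic_mean_weight // sum_refinement_terms //.
by set c := dyadic_mean a b n; set M := _ * _ `^ v; set N := 2 ^+ n => hM; lra.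
Qed.

End RefinedReverseYoung.

Theorem theorem3 (R : realType) (a b : R) (n : nat) (v : R)
    (ha : 0 < a) (hb : 0 < b) (hn : (1 <= n)%N) :
  (v \notin `[0, 1 / 2 ^+ n] ->
     (1 - v) * a + v * b <=
       a `^ (1 - v) * b `^ v +
       v * \sum_(1 <= k < n.+1)
             2 ^+ (k - 1) *
             (Num.sqrt a - realroot (2 ^ k) (a ^+ (2 ^ (k - 1) - 1) * b)) ^+ 2)
  /\
  (v \notin `[(2 ^+ n - 1) / 2 ^+ n, 1] ->
     (1 - v) * a + v * b <=
       a `^ (1 - v) * b `^ v +
       (1 - v) * \sum_(1 <= k < n.+1)
             2 ^+ (k - 1) *
             (Num.sqrt b - realroot (2 ^ k) (a * b ^+ (2 ^ (k - 1) - 1))) ^+ 2).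
Proof.
split=> hv; first exact: refined_reverse_young.
have v_out : 1 - v \notin `[0, 1 / 2 ^+ n].
  have N0 : 2 ^+ n != 0 :> R by rewrite expf_neq0 ?pnatr_eq0.
  move: hv; rewrite !in_itv /= mulrBl divff // subr_ge0 andbC.
  by rewrite lerBlDr -lerBlDl.
have := refined_reverse_young hb ha v_out.
rewrite subKr addrC [b `^ v * _]mulrC.
by under eq_bigr do rewrite [_ * a]mulrC.
Qed.
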